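(* Let $V$ be a finite set and let $r$ be any positive integer. Then the local $h$-polynomial $\ell_V\left((2^V)^{\langle r\rangle},x\right)$ of the $r$th edgewise subdivision $(2^V)^{\langle r\rangle}$ of the simplex $2^V$ has only real zeros.
   Context: For a finite set $V$ with $n$ elements, $2^V$ denotes the abstract simplex consisting of all subsets of $V$. $h$-polynomial: for a $(d-1)$-dimensional finite simplicial complex $\Delta$ with $f_i$ faces of dimension $i$ (and $f_{-1}=1$), $h(\Delta,x)=\sum_{i=0}^{d} f_{i-1}\,x^i(1-x)^{d-i}$. In particular, $h(\{\emptyset\},x)=1$. Local $h$-polynomial: if $\Gamma$ is a simplicial subdivision of $2^V$, and $\Gamma_F$ denotes the restriction of $\Gamma$ to the face $F\in 2^V$ (the subcomplex of $\Gamma$ that subdivides $2^F$), then $$\ell_V(\Gamma,x)=\sum_{F\subseteq V}(-1)^{n-|F|}\,h(\Gamma_F,x).$$ Edgewise subdivision: fix a total order $v_1,\dots,v_n$ of the elements of $V$. The $r$th edgewise subdivision $(2^V)^{\langle r\rangle}$ is the simplicial complex whose vertices are the vectors $a=(a_1,\dots,a_n)$ of nonnegative integers with $a_1+\cdots+a_n=r$. For $a\in\mathbb{Z}^n$ put $\iota(a)=(a_1,a_1+a_2,\dots,a_1+\cdots+a_n)$. A set $E$ of vertices is a face if and only if for all $a,b\in E$ one has $\iota(a)-\iota(b)\in\{0,1\}^n$ or $\iota(b)-\iota(a)\in\{0,1\}^n$. The vertex $a$ corresponds to the point of the geometric simplex on $V$ with barycentric coordinates $a/r$, so the restriction of $(2^V)^{\langle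 r\rangle}$ to a face $F\subseteq V$ consists of those faces all of whose vertices $a$ satisfy $a_i=0$ whenever $v_i\notin F$ (for $F=\emptyset$ it is $\{\emptyset\}$). A real polynomial ''has only real zeros'' if it is the zero polynomial or all its complex zeros are real. *)

(* Defs.v *)
From HB Require Import structures.
From mathcomp Require Import all_boot all_order all_algebra.
From mathcomp Require Import reals.
From mathcomp Require Import complex.

Set Implicit Arguments.
Unset Strict Implicit.
Unset Printing Implicit Defensive.

Import Order.TTheory GRing.Theory Num.Theory.
Local Open Scope ring_scope.

(* A finite abstract simplicial complex with vertices in T is the set
   D : {set {set T}} of its faces, the empty face included. *)
Section FaceEnumeration.
Variables (R : nzRingType) (T : finType).
Implicit Type D : {set {set T}}.

(* Indexed by cardinality, i.e. dimension + 1, so that no index is negative: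
   fnum D i is f_{i-1}, and cdim D is d for D of dimension d - 1. *)
Definition fnum D (i : nat) : nat := #|[set E in D | #|E| == i]|.
Definition cdim D : nat := \max_(E in D) #|E|.

Definition h_poly D : {poly R} :=
  \sum_(i < (cdim D).+1)
     (fnum D i)%:R *: ('X^i * (1 - 'X) ^+ (cdim D - i)).

(* A subdivision of 2^V enters only through its restrictions
   F |-> Gamma_F to the faces F of 2^V. *)
Definition local_h_poly (V : finType) (Gamma : {set V} -> {set {set T}})
    : {poly R} :=
  \sum_(F : {set V}) (-1) ^+ (#|V| - #|F|) * h_poly (Gamma F).

End FaceEnumeration.

(* The elements v_1, ..., v_n of the totally ordered set V index coordinates
   directly; i <= j becomes the order of V. *)
Section Edgewise.
Variables (disp : Order.disp_t) (V : finOrderType disp) (r : nat).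

(* Nonnegative integers summing to r are at most r, so coordinates may be
   taken in 'I_r.+1, which makes the ambient type of points finite. *)
Definition ew_point := {ffun V -> 'I_r.+1}.

Definition ew_vertex (a : ew_point) : bool := (\sum_(v : V) a v == r)%N.

Definition ew_iota (a : ew_point) (v : V) : int :=
  \sum_(w : V | (w <= v)%O) (a w)%:Z.

Definition ew_step (a b : ew_point) : bool :=
  [forall v, ew_iota a v - ew_iota b v \in [:: 0; 1]].

Definition edgewise : {set {set ew_point}} :=
  [set E : {set ew_point} |
    [forall a in E, ew_vertex a] &&
    [forall a in E, forall b in E, ew_step a b || ew_step b a]].

Definition edgewise_restr (F : {set V}) : {set {set ew_point}} :=
  [set E in edgewise |
    [forall a in E, forall v, (v \notin F) ==> (a v == 0 :> nat)]].

End Edgewise.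

Definition only_real_zeros (R : realType) (p : {poly R}) : Prop :=
  p = 0 \/
  forall z : complex R, root (map_poly (real_complex R) p) z ->
    complex.Im z = 0.

(* Main.v *)
(* Write E for the operator that keeps the coefficients of x^(r i) and sends
   x^(r i) to x^i, and A = 1 + x + ... + x^(r-1).

   A multiset of k points whose support is a face of the edgewise subdivision
   of 2^F is determined by its sum, a function s : F -> N with total r k, and
   every such s arises: sort the points by iota, so that the partial sums of
   the jth point must be floor((S v + j) / k), where S are the partial sums of
   s. Counting both sides gives the Hilbert series of the Stanley-Reisner ring,
   hence h = E(A^|F|), and the local h-polynomial is E((A - 1)^n) by
   inclusion-exclusion.

   Fix z with Im z > 0 and let u_i^n be the value at z of E(x^i (A - 1)^n).
   Then u_{i+r}^n = z u_i^n and u_i^{n+1} is the sum of u_{i+t}^n for 0 < t < r.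
   By induction on n, Im(conj(u_i^n) u_j^n) >= 0 whenever i <= j <= i + r. This
   positivity forces every term u_{i+t}^n to vanish as soon as the sum
   u_i^{n+1} does, so that u_i^n = 0 only if the polynomial itself is zero. *)
Require Import Defs.
From HB Require Import structures.
From mathcomp Require Import all_boot all_order all_algebra.
From mathcomp Require Import reals.
From mathcomp Require Import complex.
From mathcomp Require Import ring zify.

Set Implicit Arguments.
Unset Strict Implicit.
Unset Printing Implicit Defensive.

Import Order.TTheory GRing.Theory Num.Theory.

(** * Balanced sequences and rounding *)

Section Balanced.
Variables (k : nat) (x : nat -> nat).
Hypothesis x_mono : forall i j, i <= j < k -> x i <= x j.
Hypothesis x_step : forall i j, i < k -> j < k -> x j <= (x i).+1.

(** Every [i < k] satisfies [x j <= x i + (i < j)] and [x i + (i < j.+1) <= (x j).+1]. Summing both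
    over [i] traps the total plus [j] between [x j * k] and [(x j).+1 * k]. *)
Lemma balanced_divn j : j < k -> x j = (\sum_(i < k) x i + j) %/ k.
Proof.
move=> jk; set S := \sum_(i < k) x i.
have count_le n : n <= k -> \sum_(i < k) (i < n) = n.
  move=> nk; rewrite -[RHS]card_ord -sum1_card (big_ord_widen k (fun=> 1)) //.
  by rewrite [RHS]big_mkcond; apply: eq_bigr => i _; case: (i < n).
have lo : x j * k <= S + j.
  rewrite -[in leqRHS](count_le j (ltnW jk)) -big_split /=.
  rewrite mulnC -[in leqLHS](card_ord k) -sum_nat_const.
  apply: leq_sum => i _; have := x_step (ltn_ord i) jk.
  by have := @x_mono j i; rewrite ltn_ord; lia.
have hi : S + j < (x j).+1 * k.
  rewrite -addnS -[in leqLHS](count_le j.+1 jk) -big_split /=.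
  rewrite mulnC -[in leqRHS](card_ord k) -sum_nat_const.
  apply: leq_sum => i _; have := x_step jk (ltn_ord i).
  by have := @x_mono i j; rewrite jk; lia.
have k0 : 0 < k by apply: leq_ltn_trans jk.
by apply/eqP; rewrite eqn_leq leq_divRL // lo -ltnS ltn_divLR.
Qed.
End Balanced.

(** Hermite's identity. Passing from [S] to [S + 1] shifts the window of summands: [S %/ k] leaves
    and [(S + k) %/ k], one larger, enters. *)
Lemma sum_divn_addn k S : 0 < k -> \sum_(j < k) (S + j) %/ k = S.
Proof.
move=> k0; elim: S => [|S IH].
  by rewrite big1 // => j _; rewrite add0n divn_small.
rewrite -[RHS]addn1 -{2}IH; case: k k0 {IH} => // k _.
rewrite [LHS]big_ord_recr [in RHS]big_ord_recl /= addn0 addSnnS divnDr // divnn /=.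
rewrite addnA; congr (_ + _); rewrite [RHS]addnC; congr (_ + _).
by apply: eq_bigr => i _; rewrite /= addSnnS.
Qed.

(** * Partial sums along a finite total order *)

Section PartialSums.
Variables (disp : Order.disp_t) (V : finOrderType disp).
Implicit Types (s : V -> nat) (v w : V).

Definition psum s v := \sum_(w | (w <= v)%O) s w.
Definition psum_lt s v := \sum_(w | (w < v)%O) s w.

Lemma psumE s v : psum s v = psum_lt s v + s v.
Proof.
rewrite /psum (bigD1 v) //= addnC; congr (_ + _).
by apply: eq_bigl => w; rewrite andbC -lt_neqAle.
Qed.

Lemma psum_inj s t : psum s =1 psum t -> s =1 t.
Proof.
move=> e v; have [n] := ubnP #|[set w | (w < v)%O]|.
elim: n v => // n IH v; rewrite ltnS => ln.
apply/eqP; rewrite -(eqn_add2l (psum_lt s v)) -psumE e psumE eqn_add2r.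
apply/eqP/eq_bigr => w wv; rewrite IH // (leq_trans _ ln) //.
apply: proper_card; apply/properP; split.
  by apply/subsetP => y; rewrite !inE => /lt_trans/(_ wv).
by exists w; rewrite !inE ?ltxx.
Qed.

Section Telescope.
Variables (s : V -> nat) (phi : nat -> nat).
Hypotheses (phi0 : phi 0 = 0) (phi_mono : {homo phi : m n / m <= n}).

(** Induction on the cardinality of [A], removing its maximum: [A] is then the initial segment below
    it. Monotonicity of [phi] keeps the truncated subtractions exact. *)
Lemma telescope_psum (A : {set V}) :
    (forall v w, v \in A -> (w <= v)%O -> w \in A) ->
  \sum_(v in A) (phi (psum s v) - phi (psum_lt s v)) = phi (\sum_(v in A) s v).
Proof.
have [n] := ubnP #|A|; elim: n A => // n IH A; rewrite ltnS => An Adown.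
have [->|[v0 v0A]] := set_0Vmem A; first by rewrite !big_set0.
have [m mA0 mmax] := Order.TotalTheory.arg_maxP id v0A.
have mA : m \in A := mA0.
have eA w : (w \in A) = (w <= m)%O.
  by apply/idP/idP => [/mmax//|]; apply: Adown.
have eAm w : (w \in A :\ m) = (w < m)%O by rewrite !inE eA -lt_neqAle.
have sAm : \sum_(v in A :\ m) s v = psum_lt s m by apply: eq_bigl.
rewrite !(big_setD1 m mA) /= IH ?sAm.
- by rewrite [s m + _]addnC -psumE subnK // phi_mono // psumE leq_addr.
- by rewrite (leq_trans _ An) // [in ltnRHS](cardsD1 m) mA.
- by move=> v w; rewrite !eAm => vm wv; apply: le_lt_trans vm.
Qed.
End Telescope.
End PartialSums.

(** * Multisets supported on faces and their sums *)

Section EdgewiseMultisets.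
Variables (disp : Order.disp_t) (V : finOrderType disp) (r : nat).
Local Notation point := (ew_point V r).
Implicit Types (a b : point) (F : {set V}) (mu : point -> nat) (s : V -> nat).

Lemma ew_iotaE a v : ew_iota a v = Posz (psum (fun w => a w) v).
Proof. by rewrite /ew_iota /psum (big_morph Posz PoszD (erefl _)). Qed.

Lemma ew_stepP a b :
  reflect (forall v, psum (fun w => b w) v <= psum (fun w => a w) v <= (psum (fun w => b w) v).+1)
          (ew_step a b).
Proof.
apply: (iffP forallP) => h v; move: (h v); rewrite !ew_iotaE !inE; lia.
Qed.

(** With [mu] read as multiplicities, this is the coordinatewise sum of a multiset of points. *)
Definition weight mu v := \sum_(a : point) mu a * a v.

(* The jth of the k points into which a function s of total r k is sliced:
   its partial sums are floor((S v + j) / k), with S the partial sums of s. *)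
Definition slice k s j : point :=
  [ffun v => inord ((psum s v + j) %/ k - (psum_lt s v + j) %/ k)].

Definition slices k s a := \sum_(j < k) (slice k s j == a).

Section Slice.
Variables (k : nat) (s : V -> nat).
Hypothesis s_sum : \sum_v s v = r * k.

Lemma sum_slice_value j (A : {set V}) : j < k ->
    (forall v w, v \in A -> (w <= v)%O -> w \in A) ->
  \sum_(v in A) ((psum s v + j) %/ k - (psum_lt s v + j) %/ k) = (\sum_(v in A) s v + j) %/ k.
Proof.
move=> jk Adown; apply: (@telescope_psum _ _ s (fun n => (n + j) %/ k)) => //.
  by rewrite divn_small.
by move=> m n mn; rewrite leq_div2r // leq_add2r.
Qed.

Lemma slice_total j : j < k ->
  \sum_v ((psum s v + j) %/ k - (psum_lt s v + j) %/ k) = r.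
Proof.
move=> jk; have := @sum_slice_value j setT jk (fun _ _ _ _ => in_setT _).
have e (G : V -> nat) : \sum_(w in setT) G w = \sum_w G w.
  by apply: eq_bigl => w; rewrite inE.
(* The total is [(r * k + j) %/ k], which is [r] because [j < k]. *)
rewrite !e s_sum => ->; rewrite divnMDl ?divn_small ?addn0 //.
exact: leq_ltn_trans jk.
Qed.

(** A coordinate is at most the total [r], so [inord] does not fall back to its default value. *)
Lemma sliceE j v : j < k ->
  slice k s j v = (psum s v + j) %/ k - (psum_lt s v + j) %/ k :> nat.
Proof.
move=> jk; rewrite ffunE inordK // ltnS -[leqRHS](slice_total jk).
by rewrite (bigD1 v) //= leq_addr.
Qed.

Lemma ew_vertex_slice j : j < k -> ew_vertex (slice k s j).
Proof.
move=> jk; apply/eqP; rewrite -[RHS](slice_total jk).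
by apply: eq_bigr => v _; rewrite sliceE.
Qed.

Lemma psum_slice j v : j < k ->
  psum (fun w => slice k s j w) v = (psum s v + j) %/ k.
Proof.
move=> jk; have := @sum_slice_value j [set w | (w <= v)%O] jk.
have e (G : V -> nat) : \sum_(w in [set w | (w <= v)%O]) G w = psum G v.
  by apply: eq_bigl => w; rewrite inE.
rewrite !e => <-; last by move=> x y; rewrite !inE => xv /le_trans; apply.
by apply: eq_bigr => w _; rewrite sliceE.
Qed.

(** As [i <= j <= i + k], the floor of [(S + j) / k] is that of [(S + i) / k] or one more, for each
    partial sum [S]. *)
Lemma ew_step_slice i j : i <= j -> j < k -> ew_step (slice k s j) (slice k s i).
Proof.
move=> ij jk; have ik := leq_ltn_trans ij jk.
have k0 : 0 < k by apply: leq_ltn_trans jk.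
apply/ew_stepP => v; rewrite !psum_slice // leq_div2r ?leq_add2l //=.
have -> : ((psum s v + i) %/ k).+1 = (psum s v + i + k) %/ k.
  by rewrite [RHS]divnDr // divnn k0 addn1.
by rewrite leq_div2r //; lia.
Qed.

(** Hermite's identity recovers the partial sums up to and strictly below [v]; they differ by
    [s v]. *)
Lemma weight_slices v : weight (slices k s) v = s v.
Proof.
have [k0|k0] := posnP k.
  (* Without slices, [s] has total [r * 0] and so vanishes. *)
  rewrite /weight big1 => [|a _]; last by rewrite /slices k0 big_ord0.
  move/eqP: s_sum; rewrite k0 muln0 sum_nat_eq0 => /forallP/(_ v)/eqP/esym.
  exact.
have -> : weight (slices k s) v = \sum_(j < k) slice k s j v.
  rewrite /weight /slices; under eq_bigr do rewrite big_distrl /=.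
  rewrite exchange_big; apply: eq_bigr => j _ /=.
  rewrite (bigD1 (slice k s j)) //= eqxx mul1n big1 ?addn0 // => a.
  by rewrite eq_sym => /negbTE ->.
under eq_bigr do rewrite sliceE //.
rewrite sumnB => [|j _]; last by rewrite leq_div2r // leq_add2r psumE leq_addr.
by rewrite !sum_divn_addn // psumE addKn.
Qed.

Lemma sum_slices : \sum_a slices k s a = k.
Proof.
rewrite /slices exchange_big -[RHS]card_ord -sum1_card; apply: eq_bigr => j _ /=.
by rewrite (bigD1 (slice k s j)) //= eqxx big1 // => a; rewrite eq_sym => /negbTE ->.
Qed.

Lemma slices_face F : (forall v, v \notin F -> s v = 0) ->
  [set a | slices k s a != 0] \in edgewise_restr r F.
Proof.
move=> sF; have slP a : slices k s a != 0 -> exists2 j, j < k & a = slice k s j.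
  rewrite sum_nat_eq0 negb_forall => /existsP[j].
  by rewrite /= eqb0 negbK => /eqP <-; exists j.
rewrite !inE -andbA; apply/and3P; split.
- apply/forall_inP => a; rewrite inE => /slP[j jk ->]; exact: ew_vertex_slice.
- apply/forall_inP => a; rewrite inE => /slP[i ik ->].
  apply/forall_inP => b; rewrite inE => /slP[j jk ->].
  by case/orP: (leq_total i j) => ij; rewrite (ew_step_slice ij) ?orbT.
apply/forall_inP => a; rewrite inE => /slP[j jk ->].
by apply/forall_inP => v vF; rewrite sliceE // psumE sF // addn0 subnn.
Qed.
End Slice.

Lemma weight_supp F mu : [set a | mu a != 0] \in edgewise_restr r F ->
  forall v, v \notin F -> weight mu v = 0.
Proof.
rewrite inE => /andP[_ /forall_inP h] v vF; apply: big1 => a _.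
have [->//|ma] := eqVneq (mu a) 0.
have := h a; rewrite inE => /(_ ma)/forall_inP/(_ v vF)/eqP ->.
by rewrite muln0.
Qed.

Lemma weight_total F mu : [set a | mu a != 0] \in edgewise_restr r F ->
  \sum_v weight mu v = r * \sum_a mu a.
Proof.
rewrite !inE -andbA => /and3P[/forall_inP h _ _].
rewrite /weight exchange_big /= big_distrr /=; apply: eq_bigr => a _.
rewrite -big_distrr /= mulnC; have [->|ma] := eqVneq (mu a) 0; first by rewrite !muln0.
by congr (_ * _); apply/eqP/h; rewrite inE.
Qed.

(** The points of the multiset, sorted by iota, have at each [v] partial sums that increase and
    differ by at most one. By [balanced_divn] these are determined by their total, and they agree
    with those of the slices. *)
Lemma slices_weight F mu : [set a | mu a != 0] \in edgewise_restr r F ->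
  slices (\sum_a mu a) (weight mu) =1 mu.
Proof.
move=> face; move: (face); rewrite !inE -andbA => /and3P[_ /forall_inP hs _].
pose le a b := [forall v, psum (fun w => a w) v <= psum (fun w => b w) v].
pose l0 := flatten [seq nseq (mu a) a | a <- enum point].
pose l := sort le l0.
have l0_sum (G : point -> nat) : \sum_(a <- l0) G a = \sum_a mu a * G a.
  rewrite /l0 big_flatten big_map big_enum; apply: eq_bigr => a _.
  by rewrite big_nseq iter_addn_0 mulnC.
have l_sum (G : point -> nat) : \sum_(a <- l) G a = \sum_a mu a * G a.
  by rewrite -l0_sum; apply: perm_big; rewrite perm_sort.
set k := \sum_a mu a.
have size_l : size l = k by rewrite -sum1_size l_sum; apply: eq_bigr => a _; rewrite muln1.
have l_supp a : a \in l -> mu a != 0.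
  rewrite mem_sort => /flatten_mapP[b _]; rewrite mem_nseq => /andP[h /eqP ->].
  by rewrite -lt0n.
have cmp a b : mu a != 0 -> mu b != 0 -> ew_step a b || ew_step b a.
  by move=> ma mb; have := hs a; rewrite inE => /(_ ma)/forall_inP; apply; rewrite inE.
have le_tr : transitive le.
  move=> b a c /forallP ab /forallP bc; apply/forallP => v; exact: leq_trans (ab v) (bc v).
(* The componentwise order of iota is total only on the support, where face membership makes points
   comparable. *)
have l_sorted : sorted le l.
  apply: (@sort_sorted_in _ [pred a | mu a != 0] le) => [a b|].
    rewrite !inE => ma mb; rewrite orbC; case/orP: (cmp a b ma mb) => /ew_stepP h; apply/orP.
      by left; apply/forallP => v; case/andP: (h v).
    by right; apply/forallP => v; case/andP: (h v).
  by apply/allP => a; rewrite -(mem_sort le) => /l_supp; rewrite inE.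
have [k0|kpos] := posnP k.
  move=> a; rewrite /slices k0 big_ord0; symmetry; apply/eqP.
  by move/eqP: k0; rewrite sum_nat_eq0 => /forallP/(_ a).
have [a0 _] : exists a0 : point, true.
  by move: kpos; rewrite -size_l; case: (l) => // a0; exists a0.
pose x v j := psum (fun w => nth a0 l j w) v.
have l_mem j : j < k -> mu (nth a0 l j) != 0.
  by move=> jk; apply: l_supp; rewrite mem_nth ?size_l.
have x_sum v : \sum_(j < k) x v j = psum (weight mu) v.
  rewrite -(big_mkord xpredT (x v)) -size_l -(big_nth a0 xpredT (fun a => psum (fun w => a w) v)).
  rewrite l_sum /psum /weight exchange_big; apply: eq_bigr => a _ /=.
  by rewrite big_distrr.
have x_div v j : j < k -> x v j = (psum (weight mu) v + j) %/ k.
  move=> jk; rewrite -x_sum; apply: balanced_divn => // [i i'|i i' ik ik'].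
    case/andP; rewrite leq_eqVlt => /predU1P[->//|ii' ik'].
    have := sorted_ltn_nth le_tr a0 l_sorted i i'; rewrite !inE size_l.
    by move=> /(_ (ltn_trans ii' ik') ik' ii')/forallP/(_ v).
  have := cmp _ _ (l_mem i ik) (l_mem i' ik'); rewrite /x.
  by case/orP => /ew_stepP/(_ v)/andP[]; lia.
have wt : \sum_v weight mu v = r * k := weight_total face.
have l_slice j : j < k -> nth a0 l j = slice k (weight mu) j.
  move=> jk; apply/ffunP => v; apply: val_inj.
  (* A point is determined by its partial sums. *)
  apply: (psum_inj (s := fun w => nth a0 l j w) (t := fun w => slice k (weight mu) j w)) => {}v.
  by rewrite psum_slice // -x_div.
move=> a; rewrite /slices.
have -> : mu a = \sum_(b <- l) (b == a).
  by rewrite l_sum (bigD1 a) //= eqxx muln1 big1 ?addn0 // => b /negbTE ->; rewrite muln0.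
rewrite (big_nth a0) size_l big_mkord; apply: eq_bigr => j _.
by rewrite l_slice.
Qed.

End EdgewiseMultisets.

(** * Counting multisets on faces by their sums *)

Section CountMultisets.
Variables (disp : Order.disp_t) (V : finOrderType disp) (r : nat).
Local Notation point := (ew_point V r).
Variables (F : {set V}) (k N M : nat).
Hypotheses (kN : k <= N) (kM : r * k <= M).

(** The caps [N] and [M] give finite function types; as [k <= N] and [r * k <= M], they exclude no
    multiset of [k] points and no function of total [r * k]. *)
Let multisets := [set mu : {ffun point -> 'I_N.+1} |
  ([set a | mu a != 0 :> nat] \in edgewise_restr r F) && (\sum_a mu a == k)].
Let functions := [set s : {ffun V -> 'I_M.+1} |
  [forall v, (v \notin F) ==> (s v == 0 :> nat)] && (\sum_v s v == r * k)].
Let f (mu : {ffun point -> 'I_N.+1}) : {ffun V -> 'I_M.+1} :=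
  [ffun v => inord (weight (fun a => mu a) v)].
Let g (s : {ffun V -> 'I_M.+1}) : {ffun point -> 'I_N.+1} :=
  [ffun a => inord (slices k (fun v => s v) a)].

(** Needed since [f mu] and [weight] agree only pointwise, after coercion to [nat]. *)
Lemma eq_slices (s t : V -> nat) (a : point) : s =1 t -> slices k s a = slices k t a.
Proof.
move=> e; apply: eq_bigr => j _; congr (nat_of_bool (_ == a)).
apply/ffunP => v; rewrite !ffunE; congr (inord ((_ + _) %/ _ - (_ + _) %/ _));
  exact: eq_bigr.
Qed.

Let fE mu v : mu \in multisets -> f mu v = weight (fun a => mu a) v :> nat.
Proof.
rewrite inE => /andP[h /eqP mk]; rewrite ffunE inordK // ltnS (leq_trans _ kM) //.
by rewrite -{1}mk -(weight_total h) (bigD1 v) //= leq_addr.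
Qed.

Let gE s a : s \in functions -> g s a = slices k (fun v => s v) a :> nat.
Proof.
move=> _; rewrite ffunE inordK // ltnS (leq_trans _ kN) //.
by rewrite -[leqRHS](@sum_slices _ V r k (fun v => s v)) (bigD1 a) //= leq_addr.
Qed.

Let f_functions mu : mu \in multisets -> f mu \in functions.
Proof.
move=> mM; move: (mM); rewrite inE [in X in _ -> X]inE => /andP[h /eqP mk].
apply/andP; split.
  by apply/forall_inP => v vF; rewrite fE // (weight_supp h).
under eq_bigr do rewrite fE //.
by rewrite (weight_total h) mk.
Qed.

Let g_multisets s : s \in functions -> g s \in multisets.
Proof.
move=> sS; move: (sS); rewrite inE [in X in _ -> X]inE => /andP[/forall_inP h /eqP sk].
apply/andP; split.
  have -> : [set a | g s a != 0 :> nat] = [set a | slices k (fun v => s v) a != 0].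
    by apply/setP => a; rewrite !inE gE.
  by apply: slices_face => // v /h/eqP.
under eq_bigr do rewrite gE //.
by rewrite sum_slices.
Qed.

Let fK mu : mu \in multisets -> g (f mu) = mu.
Proof.
move=> mM; apply/ffunP => a; apply: val_inj => /=.
rewrite (gE _ (f_functions mM)) (eq_slices (t := weight (fun a => mu a))) => [|v]; last exact: fE.
by move: mM; rewrite inE => /andP[h /eqP <-]; rewrite (slices_weight h).
Qed.

Let gK s : s \in functions -> f (g s) = s.
Proof.
move=> sS; apply/ffunP => v; apply: val_inj => /=.
rewrite (fE _ (g_multisets sS)); move: (sS); rewrite inE => /andP[_ /eqP sk].
rewrite -[RHS](@weight_slices _ _ _ _ (fun v => s v) sk v).
by apply: eq_bigr => a _; rewrite gE.
Qed.

Lemma card_edgewise_multisets : #|multisets| = #|functions|.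
Proof.
rewrite -(card_in_imset (f := f)) => [|m1 m2 h1 h2 e]; last by rewrite -(fK h1) e fK.
apply: eq_card => s; apply/imsetP/idP => [[mu h ->]|sS]; first exact: f_functions.
by exists (g s); rewrite ?g_multisets ?gK.
Qed.
End CountMultisets.

Local Open Scope ring_scope.

(** * Extracting every [r]th coefficient *)

Section PolySection.
Variables (R : nzRingType) (r : nat).
Implicit Types p q : {poly R}.

(** The operator E. For [0 < r] the bound [size p] loses nothing, because [i <= r * i]. *)
Definition poly_section p : {poly R} := \poly_(i < size p) p`_(r * i).

Hypothesis r_gt0 : (0 < r)%N.

Lemma coef_poly_section p i : (poly_section p)`_i = p`_(r * i).
Proof.
rewrite coef_poly; case: ltnP => // le_pi.
by rewrite nth_default // (leq_trans le_pi) // leq_pmull.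
Qed.

Lemma poly_section0 : poly_section 0 = 0.
Proof. by apply/polyP => i; rewrite coef_poly_section !coef0. Qed.

Lemma poly_sectionD p q : poly_section (p + q) = poly_section p + poly_section q.
Proof. by apply/polyP => i; rewrite coefD !coef_poly_section coefD. Qed.

Lemma poly_section_sum (I : Type) (s : seq I) (P : pred I) (F : I -> {poly R}) :
  poly_section (\sum_(i <- s | P i) F i) = \sum_(i <- s | P i) poly_section (F i).
Proof. exact: (big_morph _ poly_sectionD poly_section0). Qed.

Lemma poly_sectionZ a p : poly_section (a *: p) = a *: poly_section p.
Proof. by apply/polyP => i; rewrite coefZ !coef_poly_section coefZ. Qed.

Lemma poly_sectionXnM k p : poly_section ('X^(r * k) * p) = 'X^k * poly_section p.
Proof.
apply/polyP => i; rewrite coef_poly_section !coefXnM coef_poly_section.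
by rewrite ltn_pmul2l // mulnBr.
Qed.

Lemma poly_sectionXn k :
  poly_section 'X^k = if (r %| k)%N then 'X^(k %/ r) else 0.
Proof.
case: ifPn => [/dvdnP[m ->]|ndv].
  rewrite mulnC -[X in poly_section X]mulr1 poly_sectionXnM mulKn //.
  rewrite -[RHS]mulr1; congr (_ * _); apply/polyP => i.
  by rewrite coef_poly_section !coef1 muln_eq0 eqn0Ngt r_gt0.
apply/polyP => i; rewrite coef_poly_section coefXn coef0.
by case: eqP => // E; rewrite -E dvdn_mulr in ndv.
Qed.
End PolySection.

(** For [n = r] this is the polynomial A. *)
Definition geo_poly (R : nzRingType) n : {poly R} := \sum_(i < n) 'X^i.

(** * The cross product on the complex plane *)

Section Cross.
Variable R : realType.
Local Notation C := (complex R).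
Local Notation Re := complex.Re.
Local Notation Im := complex.Im.
Implicit Types z w : C.

(** This is Im(conj(z) w). *)
Definition cross z w : R := Re z * Im w - Im z * Re w.

Lemma crossDl z1 z2 w : cross (z1 + z2) w = cross z1 w + cross z2 w.
Proof. by case: z1 z2 w => [a b] [c d] [e f]; rewrite /cross /=; ring. Qed.

Lemma crossDr z w1 w2 : cross z (w1 + w2) = cross z w1 + cross z w2.
Proof. by case: z w1 w2 => [a b] [c d] [e f]; rewrite /cross /=; ring. Qed.

Lemma cross0l w : cross 0 w = 0.
Proof. by rewrite /cross /= !mul0r subr0. Qed.

Lemma cross0r w : cross w 0 = 0.
Proof. by rewrite /cross /= !mulr0 subr0. Qed.

Lemma crossxx z : cross z z = 0.
Proof. by rewrite /cross mulrC subrr. Qed.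

Lemma crossZ z w : cross w (z * w) = (Re w ^+ 2 + Im w ^+ 2) * Im z.
Proof. by case: z w => [a b] [c d]; rewrite /cross /=; ring. Qed.

Lemma cross_suml (I : Type) (s : seq I) (P : pred I) (F : I -> C) w :
  cross (\sum_(i <- s | P i) F i) w = \sum_(i <- s | P i) cross (F i) w.
Proof.
exact: (big_morph (fun z => cross z w) (fun z1 z2 => crossDl z1 z2 w) (cross0l w)).
Qed.

Lemma cross_sumr (I : Type) (s : seq I) (P : pred I) (F : I -> C) w :
  cross w (\sum_(i <- s | P i) F i) = \sum_(i <- s | P i) cross w (F i).
Proof. exact: (big_morph (cross w) (crossDr w) (cross0r w)). Qed.

Lemma crossZ_ge0 z w : 0 <= Im z -> 0 <= cross w (z * w).
Proof. by move=> z0; rewrite crossZ mulr_ge0 // addr_ge0 ?sqr_ge0. Qed.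

Lemma crossZ_le0 z w : 0 < Im z -> cross w (z * w) <= 0 -> w = 0.
Proof.
move=> z0; rewrite crossZ pmulr_lle0 // => h.
have /eqP: Re w ^+ 2 + Im w ^+ 2 = 0 by apply/eqP; rewrite eq_le h addr_ge0 ?sqr_ge0.
rewrite paddr_eq0 ?sqr_ge0 // !sqrf_eq0 => /andP[/eqP a /eqP b].
by case: w a b {h} => /= ? ? -> ->.
Qed.
End Cross.

(** * Positivity under window sums *)

Section InterlacingStep.
Variables (R : realType) (r : nat) (z : complex R).
Hypothesis z_upper : 0 < complex.Im z.

Definition cross_monotone (u : nat -> complex R) :=
  forall i j, (i <= j <= i + r)%N -> 0 <= cross (u i) (u j).

Variables (u v : nat -> complex R).
Hypotheses (uD : forall i, u (i + r)%N = z * u i) (u_mono : cross_monotone u).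
Hypothesis v_sum : forall i, v i = \sum_(i.+1 <= t < i + r) u t.

Lemma cross_sum_ge0 a b c d : (forall i j, a <= i < b -> c <= j < d -> i <= j <= i + r)%N ->
  0 <= cross (\sum_(a <= i < b) u i) (\sum_(c <= j < d) u j).
Proof.
move=> h; rewrite cross_suml big_nat_cond sumr_ge0 // => i /andP[hi _].
rewrite cross_sumr big_nat_cond sumr_ge0 // => j /andP[hj _].
exact: u_mono (h i j hi hj).
Qed.

Lemma sum_shift a b : \sum_(a + r <= t < b + r) u t = z * \sum_(a <= t < b) u t.
Proof. by rewrite mulr_sumr big_addn addnK; apply: eq_bigr => t _; rewrite uD. Qed.

Lemma v_shift i : v (i + r) = z * v i.
Proof. by rewrite !v_sum -sum_shift. Qed.

(** For [i < j < i + r], let M and T be the sums of [u t] over [i < t < j] and [j < t < i + r]. Then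
    [v i] is M + [u j] + T and [v j] is T + [u (i + r)] + zM. On expanding, the pair (T, T) gives 0,
    (M, zM) is nonnegative since Im z > 0, and all other pairs have indices at most [r] apart. *)
Lemma cross_monotone_step : cross_monotone v.
Proof.
move=> i j /andP[]; rewrite leq_eqVlt => /predU1P[<- _|ltij]; first by rewrite crossxx.
rewrite leq_eqVlt => /predU1P[->|ltj]; first by rewrite v_shift crossZ_ge0 // ltW.
have -> : v i = \sum_(i.+1 <= t < j) u t + (u j + \sum_(j.+1 <= t < i + r) u t).
  by rewrite v_sum (big_cat_nat (n := j)) // 1?ltnW // (big_ltn ltj).
have -> : v j = \sum_(j.+1 <= t < i + r) u t + (u (i + r)%N + z * \sum_(i.+1 <= t < j) u t).
  rewrite v_sum (big_cat_nat (n := i + r)) //; last by rewrite leq_add2r ltnW.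
  by rewrite -sum_shift addSn -big_ltn // ltn_add2r.
have s1 k : u k = \sum_(k <= t < k.+1) u t by rewrite big_nat1.
rewrite !crossDl !crossDr crossxx.
have := crossZ_ge0 (\sum_(i.+1 <= t < j) u t) (ltW z_upper).
rewrite -sum_shift (s1 j) (s1 (i + r)%N) => hM.
by do ![exact: lexx | exact: hM | apply: cross_sum_ge0 => a b; lia | apply: addr_ge0].
Qed.

(** Strong induction on [t]. Once earlier terms vanish, crossing [v i = 0] with [u (t + r)] writes 0
    as [cross (u t) (z * u t)] plus nonnegative terms, which forces [u t = 0]. *)
Lemma v_eq0 i : v i = 0 -> forall t, (i < t < i + r)%N -> u t = 0.
Proof.
move=> v0 t; elim/ltn_ind: t => t IH /andP[it tr].
apply: crossZ_le0 z_upper _; rewrite -uD.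
have : cross (v i) (u (t + r)%N) = 0 by rewrite v0 cross0l.
rewrite v_sum (big_cat_nat (n := t)) //=; last by rewrite ltnW.
rewrite big_nat_cond big1 => [|k]; last first.
  by rewrite andbT => /andP[ik kt]; rewrite IH // ik (ltn_trans kt).
rewrite add0r big_ltn // crossDl => /eqP; rewrite addr_eq0 => /eqP ->.
rewrite oppr_le0 cross_suml big_nat_cond sumr_ge0 // => k.
by rewrite andbT => hk; apply: u_mono; lia.
Qed.
End InterlacingStep.

(** * Real zeros of the section of (A - 1)^n *)

Section RealRooted.
Variables (R : realType) (r : nat).
Hypothesis r_gt0 : (0 < r)%N.

Let q : {poly R} := geo_poly R r - 1.
Let P n i : {poly R} := poly_section r ('X^i * q ^+ n).

Let geo_poly_sub1 : q = \sum_(1 <= t < r) 'X^t.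
Proof.
rewrite /q /geo_poly -(big_mkord xpredT (fun i => 'X^i : {poly R})).
by rewrite big_ltn // addrC expr0 addKr.
Qed.

Let PS n i : P n.+1 i = \sum_(i.+1 <= t < i + r) P n t.
Proof.
rewrite /P exprSr mulrA {2}geo_poly_sub1 mulr_sumr poly_section_sum //.
rewrite -(add1n i) big_addn addKn.
by apply: eq_bigr => t _; rewrite mulrAC -exprD addnC.
Qed.

Let PD n i : P n (i + r) = 'X * P n i.
Proof. by rewrite /P addnC exprD -mulrA -[in 'X^r](muln1 r) poly_sectionXnM. Qed.

Let ev z (p : {poly R}) : complex R := (map_poly (real_complex R) p).[z].

Let evS z n i : ev z (P n.+1 i) = \sum_(i.+1 <= t < i + r) ev z (P n t).
Proof. by rewrite PS /ev rmorph_sum horner_sum. Qed.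

Let evD z n i : ev z (P n (i + r)) = z * ev z (P n i).
Proof. by rewrite PD /ev rmorphM /= map_polyX hornerM hornerX. Qed.

Let ev0 z i : ev z (P 0 i) = if (r %| i)%N then z ^+ (i %/ r) else 0.
Proof.
rewrite /ev /P expr0 mulr1 poly_sectionXn //; case: ifP => _.
  by rewrite map_polyXn hornerXn.
by rewrite rmorph0 horner0.
Qed.

Let ev_mono z n : 0 < complex.Im z -> cross_monotone r (fun i => ev z (P n i)).
Proof.
move=> z0; elim: n => [|n IH]; last exact: (cross_monotone_step z0 (evD z n) IH (evS z n)).
move=> i j /andP[le1 le2]; rewrite !ev0.
case: ifP => [/dvdnP[a ai]|_]; last by rewrite cross0l.
case: ifP => [/dvdnP[b bj]|_]; last by rewrite cross0r.
(* Only multiples of [r] give nonzero values, and two of them at distance at most [r] are equal or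
   consecutive. *)
rewrite ai bj !mulnK //; move: le1 le2; rewrite ai bj -mulSnr !leq_pmul2r //.
rewrite leq_eqVlt => /predU1P[->|ab]; first by rewrite crossxx.
rewrite leq_eqVlt ltnS leqNgt ab orbF => /eqP ->.
by rewrite exprS crossZ_ge0 // ltW.
Qed.

(** By [v_eq0] a zero of the sum is a zero of every summand, and by induction each summand is the
    zero polynomial. *)
Let ev_eq0 z n i : 0 < complex.Im z -> ev z (P n i) = 0 -> P n i = 0.
Proof.
move=> z0; elim: n i => [|n IH] i.
  rewrite ev0 /P expr0 mulr1 poly_sectionXn //; case: ifP => // _ /eqP.
  by rewrite expf_eq0 => /andP[_ /eqP zz]; rewrite zz ltxx in z0.
move=> h; rewrite PS big_nat_cond big1 // => t; rewrite andbT => ht; apply: IH.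
exact: (@v_eq0 R r z z0 (fun i => ev z (P n i)) (fun i => ev z (P n.+1 i))
  (evD z n) (@ev_mono z n z0) (evS z n) i h t ht).
Qed.

Lemma real_zeros_section_geo_poly n :
  only_real_zeros (poly_section r ((geo_poly R r - 1) ^+ n)).
Proof.
have -> : poly_section r ((geo_poly R r - 1) ^+ n) = P n 0 by rewrite /P expr0 mul1r.
have [->|nz] := eqVneq (P n 0) 0; [by left|right => z rz].
have [z0|z0|//] := ltgtP (complex.Im z) 0; last first.
  by move: nz; rewrite (ev_eq0 z0 (eqP rz)) eqxx.
(* The coefficients are real, so a zero in the lower half-plane has its conjugate as a zero in the
   upper one. *)
have cz : 0 < complex.Im (conjc z) by case: z z0 {rz} => a b /=; rewrite oppr_gt0.
have /(ev_eq0 cz) e : ev (conjc z) (P n 0) = 0.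
  rewrite /ev; have -> : map_poly (real_complex R) (P n 0) =
      map_poly conjc (map_poly (real_complex R) (P n 0)).
    by rewrite -map_poly_comp; apply: eq_map_poly => a /=; rewrite oppr0.
  by rewrite horner_map (eqP rz) rmorph0.
by rewrite e eqxx in nz.
Qed.
End RealRooted.

(** * Generating functions of multisets and functions *)

Section GeneratingFunctions.
Variable R : comNzRingType.

Lemma coef_sum_Xn (I : finType) (P : pred I) (w : I -> nat) k :
  (\sum_(i | P i) 'X^(w i) : {poly R})`_k = #|[set i | P i && (w i == k)]|%:R.
Proof.
rewrite coef_sum -sum1_card natr_sum.
rewrite (eq_bigl (fun i => P i && (w i == k))) => [|i]; last by rewrite inE.
by rewrite big_mkcondr; apply: eq_bigr => i _; rewrite coefXn eq_sym; case: eqP.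
Qed.

(** Sort the multisets by support [E]: points of [E] have multiplicity 1 to [N], the others 0, and
    the sum factors over points. *)
Lemma gf_multisets (T : finType) (D : {set {set T}}) N :
  \sum_(mu : {ffun T -> 'I_N.+1} | [set a | mu a != 0 :> nat] \in D) 'X^(\sum_a mu a)
  = \sum_(E in D) (\sum_(j < N) 'X^(j.+1) : {poly R}) ^+ #|E|.
Proof.
rewrite (partition_big (fun mu : {ffun T -> 'I_N.+1} => [set a | mu a != 0 :> nat]) (mem D)) //=.
apply: eq_bigr => E ED.
transitivity (\prod_(a : T) \sum_(j < N.+1 | (j != 0 :> nat) == (a \in E)) ('X^j : {poly R})).
  rewrite bigA_distr_big_dep; apply: eq_big => [mu|mu _]; last by rewrite expr_sum.
  apply/andP/familyP => [[_ /eqP <-] a|h]; first by rewrite unfold_in inE.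
  have -> : [set a | mu a != 0 :> nat] = E; last by rewrite eqxx.
  by apply/setP => a; rewrite inE; have := h a; rewrite unfold_in => /eqP.
rewrite (bigID (mem E)) /= [X in _ * X]big1 ?mulr1 => [|a /negbTE ->].
  rewrite -prodr_const; apply: eq_bigr => a ->.
  by rewrite big_mkcond big_ord_recl /= add0r.
by rewrite big_mkcond big_ord_recl /= expr0 big1 ?addr0.
Qed.

Lemma gf_functions (V : finType) (F : {set V}) M :
  \sum_(s : {ffun V -> 'I_M.+1} | [forall v, (v \notin F) ==> (s v == 0 :> nat)])
     'X^(\sum_v s v)
  = geo_poly R M.+1 ^+ #|F|.
Proof.
transitivity (\prod_(v : V) \sum_(j < M.+1 | (v \notin F) ==> (j == 0 :> nat)) ('X^j : {poly R})).
  rewrite bigA_distr_big_dep; apply: eq_big => [s|s _]; last by rewrite expr_sum.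
  by apply/forallP/familyP => h v; have := h v; rewrite unfold_in.
rewrite (bigID (mem F)) /= [X in _ * X]big1 ?mulr1 => [|v /negbTE ->].
  by rewrite -prodr_const; apply: eq_bigr => v ->.
by rewrite big_mkcond big_ord_recl /= expr0 big1 ?addr0.
Qed.

Lemma oneB_mul_geo_poly n : (1 - 'X) * geo_poly R n = 1 - 'X^n.
Proof. by rewrite /geo_poly -opprB mulNr -subrX1 opprB. Qed.

(** Division by [m] with remainder writes each exponent below [m * n] uniquely. *)
Lemma geo_poly_mul m n :
  geo_poly R (m * n) = geo_poly R m * (geo_poly R n \Po 'X^m).
Proof.
elim: n => [|n IH]; first by rewrite muln0 /geo_poly !big_ord0 comp_poly0 mulr0.
rewrite mulnSr /geo_poly big_split_ord /= -/(geo_poly R (m * n)) IH.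
rewrite [in RHS]big_ord_recr /= raddfD /= mulrDr; congr (_ + _).
rewrite comp_Xn_poly -exprM mulr_suml.
by apply: eq_bigr => i _; rewrite -exprD addnC.
Qed.

Lemma poly_section_comp r p q : (0 < r)%N ->
  poly_section r (p * (q \Po 'X^r)) = poly_section r p * q :> {poly R}.
Proof.
move=> r0; rewrite comp_polyE mulr_sumr poly_section_sum // -[in RHS](coefK q).
rewrite poly_def mulr_sumr; apply: eq_bigr => i _.
by rewrite -!scalerAr poly_sectionZ // -exprM mulrC poly_sectionXnM // mulrC.
Qed.
End GeneratingFunctions.

(** * Congruence modulo a power of x *)

Section CoefficientCongruence.
Variables (R : comNzRingType) (n : nat).
Implicit Types p q : {poly R}.

(** Congruence modulo x^n lets truncated polynomials stand for Hilbert series. *)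
Definition eq_coef_upto p q := forall k, (k < n)%N -> p`_k = q`_k.

Lemma eq_coef_upto_mul p p' q q' :
  eq_coef_upto p p' -> eq_coef_upto q q' -> eq_coef_upto (p * q) (p' * q').
Proof.
move=> ep eq_q k kn; rewrite !coefM; apply: eq_bigr => i _.
by rewrite ep ?eq_q // (leq_ltn_trans _ kn) ?leq_subr // -ltnS.
Qed.

Lemma eq_coef_upto_exp p q e : eq_coef_upto p q -> eq_coef_upto (p ^+ e) (q ^+ e).
Proof.
move=> pq; elim: e => [|e IH]; first by rewrite !expr0.
by rewrite !exprS; apply: eq_coef_upto_mul.
Qed.

Lemma eq_coef_upto_sum (I : finType) (P : pred I) (f g : I -> {poly R}) :
  (forall i, P i -> eq_coef_upto (f i) (g i)) ->
  eq_coef_upto (\sum_(i | P i) f i) (\sum_(i | P i) g i).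
Proof. by move=> h k kn; rewrite !coef_sum; apply: eq_bigr => i /h; apply. Qed.

Lemma eq_coef_upto_subXn p m : (n <= m)%N -> eq_coef_upto (p - 'X^m) p.
Proof.
move=> nm k kn; rewrite coefB coefXn; have /ltn_eqF -> := leq_trans kn nm.
by rewrite subr0.
Qed.
End CoefficientCongruence.

(** * The h-polynomials of the edgewise subdivision *)

Section HPolynomial.
Variables (R : numDomainType).

Section Complex.
Variables (T : finType) (D : {set {set T}}).

Lemma h_polyE : h_poly R D = \sum_(E in D) 'X^#|E| * (1 - 'X) ^+ (cdim D - #|E|).
Proof.
rewrite /h_poly.
rewrite (partition_big (fun E : {set T} => inord #|E| : 'I_(cdim D).+1) xpredT) //=.
apply: eq_bigr => i _; rewrite /fnum -sum1_card natr_sum scaler_suml.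
apply: eq_big => [E|E]; last by rewrite inE => /andP[_ /eqP ->]; rewrite scale1r.
rewrite inE; case DE: (E \in D) => //=; rewrite -val_eqE /= inordK // ltnS.
exact: leq_bigmax_cond.
Qed.

(** At 1 each face of maximal cardinality contributes 1, and no face contributes a negative
    amount. *)
Lemma h_poly_eval1 : set0 \in D -> (h_poly R D).[1] != 0.
Proof.
move=> D0; have [|E ED dE] := @eq_bigmax_cond _ (mem D) (fun E => #|E|).
  by apply/card_gt0P; exists set0.
rewrite h_polyE horner_sum gt_eqF // (bigD1 E) //=.
have -> : cdim D = #|E| by [].
rewrite subnn expr0 mulr1 hornerXn expr1n ltr_wpDr // sumr_ge0 // => S _.
rewrite hornerM hornerXn expr1n mul1r horner_exp !hornerE subrr.
exact: exprn_ge0.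
Qed.

(** Modulo x^(N+1) the inner sum is x/(1 - x), so each face contributes its term of [h_polyE]. *)
Lemma h_poly_hilbert N :
  eq_coef_upto N.+1 ((1 - 'X) ^+ cdim D * \sum_(E in D) (\sum_(j < N) 'X^(j.+1)) ^+ #|E|)
    (h_poly R D).
Proof.
rewrite h_polyE mulr_sumr; apply: eq_coef_upto_sum => E ED.
have /subnK {1}<- : (#|E| <= cdim D)%N by exact: leq_bigmax_cond.
rewrite exprD -mulrA -exprMn mulrC; apply: eq_coef_upto_mul => //.
apply: eq_coef_upto_exp.
have -> : \sum_(j < N) 'X^(j.+1) = 'X * geo_poly R N.
  by rewrite mulr_sumr; apply: eq_bigr => j _; rewrite exprS.
rewrite mulrCA oneB_mul_geo_poly mulrBr mulr1 -exprS.
exact: eq_coef_upto_subXn.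
Qed.
End Complex.

Section EdgewiseHPolynomial.
Variables (disp : Order.disp_t) (V : finOrderType disp) (r : nat).
Hypothesis r_gt0 : (0 < r)%N.
Variable F : {set V}.
Let D := edgewise_restr r F.
Let A := poly_section r (geo_poly R r ^+ #|F|).

Let hilbert N : eq_coef_upto N.+1
  (\sum_(E in D) (\sum_(j < N) 'X^(j.+1)) ^+ #|E|) (A * geo_poly R N.+1 ^+ #|F|).
Proof.
move=> k; rewrite ltnS => kN; rewrite -gf_multisets coef_sum_Xn.
(* The cap is chosen so that [M.+1 = r * N.+1], which [geo_poly_mul] factors. *)
rewrite (@card_edgewise_multisets _ _ _ _ _ _ (r * N.+1).-1) //; last first.
  by rewrite -ltnS prednK ?muln_gt0 ?r_gt0 // ltn_pmul2l // ltnS.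
rewrite -coef_sum_Xn gf_functions prednK ?muln_gt0 ?r_gt0 //.
by rewrite geo_poly_mul exprMn -rmorphXn /= -coef_poly_section // poly_section_comp.
Qed.

Let h_poly_cross : (1 - 'X) ^+ #|F| * h_poly R D = (1 - 'X) ^+ cdim D * A.
Proof.
apply/polyP => N.
rewrite -(@eq_coef_upto_mul _ N.+1 _ _ _ _ (fun _ _ => erefl) (@h_poly_hilbert _ D N)) //.
rewrite mulrCA (@eq_coef_upto_mul _ N.+1 _ _ _ _ (fun _ _ => erefl)
  (@eq_coef_upto_mul _ N.+1 _ _ _ _ (fun _ _ => erefl) (@hilbert N))) //.
(* The factor (1 - x)(1 + ... + x^N) is congruent to 1 modulo x^(N+1). *)
rewrite (mulrCA _ A) -exprMn oneB_mul_geo_poly; apply: (@eq_coef_upto_mul _ N.+1) => //.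
have /(@eq_coef_upto_exp _ _ _ _ #|F|) := @eq_coef_upto_subXn R N.+1 1 N.+1 (leqnn _).
rewrite expr1n => /(@eq_coef_upto_mul _ _ A A _ _ (fun _ _ => erefl)).
by rewrite mulr1.
Qed.

(** The coefficients of [A] are nonnegative, being counts of functions, and its constant term is
    1. *)
Let A_eval1 : A.[1] != 0.
Proof.
have A_ge0 i : 0 <= (geo_poly R r ^+ #|F|)`_i.
  by rewrite -(prednK r_gt0) -gf_functions coef_sum_Xn ler0n.
have A0 : A`_0 = 1.
  rewrite coef_poly_section // muln0 -horner_coef0 horner_exp horner_coef0.
  rewrite /geo_poly -(prednK r_gt0) big_ord_recl expr0 coefD coef1 coef_sum big1 ?addr0 ?expr1n //.
  by move=> i _; rewrite coefXn.
rewrite gt_eqF // horner_coef; under eq_bigr do rewrite expr1n mulr1.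
have sA : (0 < size A)%N.
  by rewrite size_poly_gt0; apply/eqP => E; move/eqP: A0; rewrite E coef0 eq_sym oner_eq0.
rewrite -(prednK sA) big_ord_recl A0 ltr_wpDr // sumr_ge0 // => i _.
by rewrite coef_poly_section.
Qed.

(* Cancelling powers of 1 - x in h_poly_cross leaves two polynomials that do not
   vanish at 1, so the dimension of the complex need not be computed. *)
Lemma h_poly_edgewise_restr : h_poly R D = A.
Proof.
have X1 : 1 - 'X != 0 :> {poly R} by rewrite -opprB oppr_eq0 polyXsubC_eq0.
have ev1 k (p : {poly R}) : (0 < k)%N -> ((1 - 'X) ^+ k * p).[1] = 0.
  by move=> k0; rewrite hornerM horner_exp !hornerE subrr expr0n gtn_eqF // mul0r.
have D0 : set0 \in D.
  by rewrite !inE -andbA; apply/and3P; split; apply/forall_inP => a; rewrite inE.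
have /eqP := h_poly_cross.
have [lt|gt|->] := ltngtP #|F| (cdim D).
- rewrite -(subnK (ltnW lt)) addnC exprD -mulrA (inj_eq (mulfI _)) ?expf_neq0 // => /eqP h.
  by have := h_poly_eval1 D0; rewrite h ev1 ?eqxx // subn_gt0.
- rewrite -(subnK (ltnW gt)) addnC exprD -mulrA (inj_eq (mulfI _)) ?expf_neq0 // => /eqP h.
  by move: A_eval1; rewrite -h ev1 ?eqxx // subn_gt0.
by rewrite (inj_eq (mulfI _)) ?expf_neq0 // => /eqP.
Qed.
End EdgewiseHPolynomial.

Lemma local_h_poly_edgewise (disp : Order.disp_t) (V : finOrderType disp) r : (0 < r)%N ->
  local_h_poly R (@edgewise_restr disp V r) = poly_section r ((geo_poly R r - 1) ^+ #|V|).
Proof.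
move=> r0; rewrite /local_h_poly.
under eq_bigr do rewrite h_poly_edgewise_restr //.
transitivity (poly_section r
  (\sum_(F : {set V}) (-1) ^+ (#|V| - #|F|) *: geo_poly R r ^+ #|F|)).
  rewrite poly_section_sum //; apply: eq_bigr => F _.
  by rewrite poly_sectionZ // -signr_odd mulr_sign -signr_odd scaler_sign.
(* Expand (A - 1)^n as a product over [V], with [F] the set of factors from which A is taken. *)
congr poly_section; rewrite -prodr_const bigA_distr.
rewrite [RHS](eq_bigl xpredT) => [|F]; last by rewrite inE.
apply: eq_bigr => F _; rewrite (bigID (mem F)) /= mulrC.
rewrite (eq_bigr (fun=> -1)) => [|v /negbTE -> //].
rewrite [X in _ * X](eq_bigr (fun=> geo_poly R r)) => [|v -> //].
rewrite !prodr_const -signr_odd -[in RHS]signr_odd mulr_sign scaler_sign.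
by rewrite -(cardC (mem F)) addKn.
Qed.
End HPolynomial.

Theorem theorem1 (R : realType) (disp : Order.disp_t) (V : finOrderType disp)
    (r : nat) (hr : (0 < r)%N) :
  only_real_zeros (local_h_poly R (@edgewise_restr disp V r)).
Proof.
rewrite local_h_poly_edgewise //; exact: real_zeros_section_geo_poly.
Qed.
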